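(* Let $\mathcal{P}_0\subset\mathcal{P}$. Suppose that there exist deterministic rate functions $g,h$ tending to zero as $n\to\infty$ and functions $\xi,\xi':[0,1]\times[0,1]^d\to\mathbb{R}$ such that (i) $\|F_{X\mid Z}-\hat F^{(n)}_{X\mid Z}\|_{\mathcal{T},\infty}\in\mathcal{O}_{\mathcal{P}_0}(g(n))$ and $\|F_{Y\mid Z}-\hat F^{(n)}_{Y\mid Z}\|'_{\mathcal{T},\infty}\in\mathcal{O}_{\mathcal{P}_0}(h(n))$; (ii) $\|\xi-\hat F^{(n)}_{X\mid Z}\|_{\mathcal{T}^c,\infty}\in\mathcal{O}_{\mathcal{P}_0}(g(n))$ and $\|\xi'-\hat F^{(n)}_{Y\mid Z}\|'_{\mathcal{T}^c,\infty}\in\mathcal{O}_{\mathcal{P}_0}(h(n))$. For $\lambda>0$ let $\mathcal{A}_\lambda\subset\mathcal{P}_0\setminus\mathcal{H}$ be the set of distributions $P$ for which $|(\rho_P)_{k\ell}|>\lambda$ for at least one combination of $k,\ell=1,\dots,q$, where $\rho_P=E_P(\phi(U_1)\phi(U_2)^T)$. For $\alpha\in(0,1)$ let $\hat\Psi_n=1(T_n>n^{-1}z_{1-\alpha})$, where $z_{1-\alpha}$ is the $(1-\alpha)$-quantile of the $\chi^2_{q^2}$-distribution. Then for all fixed levels $\alpha\in(0,1)$ the test $\hat\Psi_n$ has asymptotic uniform power against $\mathcal{A}_\lambda$ for each $\lambda>0$, i.e. $$\liminf_{n\to\infty}\inf_{P\in\mathcal{A}_\lambda}E_P(\hat\Ps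i_n)=1.$$
   Context: $\mathcal{P}$ is the set of distributions of $(X,Y,Z)$ on $[0,1]^{2+d}$ ($X,Y\in[0,1]$, $Z\in[0,1]^d$) absolutely continuous with respect to Lebesgue measure; $\mathcal{H}\subset\mathcal{P}$ is the subset for which $X$ and $Y$ are conditionally independent given $Z$. Throughout, for every $z$ the conditional distributions of $X$ and of $Y$ given $Z=z$ are continuous. $F_{X\mid Z}(t\mid z)=P(X\le t\mid Z=z)$ and $Q_{X\mid Z}(\tau\mid z)=\inf\{t\in[0,1]:F_{X\mid Z}(t\mid z)\ge\tau\}$; similarly for $Y$. $U_1=F_{X\mid Z}(X\mid Z)$, $U_2=F_{Y\mid Z}(Y\mid Z)$. $(X_i,Y_i,Z_i)_{i=1}^n$ is an i.i.d. sample from $P$. An estimator $\hat F^{(n)}_{X\mid Z}$ is a mapping from the sample $(X_i,Z_i)_{i=1}^n$ to functions $\hat F^{(n)}_{X\mid Z}(\cdot\mid z):[0,1]\to[0,1]$ that for every $z\in[0,1]^d$ are continuous and increasing with value $0$ at $0$ and $1$ at $1$; similarly $\hat F^{(n)}_{Y\mid Z}$ is such a mapping from $(Y_i,Z_i)_{i=1}^n$. Put $\hat U_{1,i}=\hat F^{(n)}_{X\mid Z}(X_i\mid Z_i)$ and $\hat U_{2,i}=\hat F^{(n)}_{Y\mid Z}(Y_i\mid Z_i)$. The function $\phi=(\phi_1,\dots,\phi_q):[0,1]\to\mathbb{R}^q$ satisfies: each $\phi_k$ has support $\mathcal{T}_k$ that is a compact subset of $(0,1)$; each $\phi_k$ is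 Lipschitz continuous; $\int_0^1\phi_k(u)\,\mathrm{d}u=0$ and $\int_0^1\phi_k(u)^2\,\mathrm{d}u=1$; $\phi_1,\dots,\phi_q$ are linearly independent. $\hat\rho_n=\frac1n\sum_{i=1}^n\phi(\hat U_{1,i})\phi(\hat U_{2,i})^T$, $\Sigma_{k,s}=\int_0^1\phi_k(u)\phi_s(u)\,\mathrm{d}u$, and $T_n=\|\Sigma^{-1/2}\hat\rho_n\Sigma^{-1/2}\|_F^2$ with $\|\cdot\|_F$ the Frobenius norm. $\tau_{\min}=\inf(\mathcal{T}_1\cup\dots\cup\mathcal{T}_q)$, $\tau_{\max}=\sup(\mathcal{T}_1\cup\dots\cup\mathcal{T}_q)$, $\mathcal{T}=[\tau_{\min},\tau_{\max}]$. $\|f\|_{\mathcal{T},\infty}=\sup_{z\in[0,1]^d}\sup_{t\in Q_{X\mid Z}(\mathcal{T}\mid z)}|f(t,z)|$ with $Q_{X\mid Z}(\mathcal{T}\mid z)=[Q_{X\mid Z}(\tau_{\min}\mid z),Q_{X\mid Z}(\tau_{\max}\mid z)]$, and $\|f\|_{\mathcal{T}^c,\infty}$ is the same with the inner supremum over the complement $[0,1]\setminus Q_{X\mid Z}(\mathcal{T}\mid z)$. $\|\cdot\|'_{\mathcal{T},\infty}$ and $\|\cdot\|'_{\mathcal{T}^c,\infty}$ are defined in the same way with $Q_{Y\mid Z}$ in place of $Q_{X\mid Z}$. For a set $\mathcal{M}$ of distributions, $X_n\in\mathcal{O}_{\mathcal{M}}(a_n)$ ($a_n$ nonzero) means: for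 every $\epsilon>0$ there is $M>0$ with $\sup_n\sup_{P\in\mathcal{M}}P(|X_n/a_n|>M)<\epsilon$. *)

(* Defs.v *)
From HB Require Import structures.
From mathcomp Require Import all_boot all_order all_algebra.
From mathcomp Require Import all_classical all_reals all_analysis.
From mathcomp Require Import measurable_realfun.
Set Implicit Arguments.
Unset Strict Implicit.
Unset Printing Implicit Defensive.
Import Order.TTheory GRing.Theory Num.Theory.
Import numFieldNormedType.Exports.
Local Open Scope classical_set_scope.
Local Open Scope ring_scope.

Section product_power.
Context d (T : measurableType d) (R : realType).

Definition tcons n (w : T * n.-tuple T) : n.+1.-tuple T :=
  [the n.+1.-tuple T of w.1 :: w.2].

Lemma measurable_tcons n : measurable_fun setT (@tcons n).
Proof. exact: measurable_cons. Qed.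

HB.instance Definition _ n :=
  isMeasurableFun.Build _ _ _ _ (@tcons n) (@measurable_tcons n).

(* The n-fold product P (x) ... (x) P, i.e. the law of an i.i.d. sample of size
   n from P, built coordinate by coordinate. *)
Fixpoint iid (P : probability T R) n : probability (n.-tuple T) R :=
  match n with
  | 0 => \d_ ([tuple] : 0.-tuple T)
  | m.+1 => distribution (P \x iid P m)%E (@tcons m)
  end.

End product_power.

Section chi_squared.
Context (R : realType).
Notation mu := (@lebesgue_measure R).

Definition Gamma (a : R) : R :=
  \int[mu]_(t in `]0, +oo[) (t `^ (a - 1) * expR (- t)).

Definition chi2_pdf (k : nat) (x : R) : R :=
  x `^ (k%:R / 2 - 1) * expR (- x / 2) / (2 `^ (k%:R / 2) * Gamma (k%:R / 2)).

Definition chi2_cdf (k : nat) (x : R) : R :=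
  \int[mu]_(t in `]0, x]) chi2_pdf k t.

Definition chi2_quantile (k : nat) (p : R) : R :=
  inf [set x : R | p <= chi2_cdf k x].

End chi_squared.

Section matrices.
Context (R : realType) (q : nat).

Definition posdefmx (S : 'M[R]_q) : Prop :=
  S^T = S /\ forall v : 'rV[R]_q, v != 0 -> 0 < (v *m S *m v^T) 0 0.

(* A^{-1/2}: the positive definite square root of A^{-1}.  It exists and is
   unique for positive definite A; the value 1%:M is a dummy otherwise. *)
Definition invsqrtmx (A : 'M[R]_q) : 'M[R]_q :=
  xget 1%:M [set S | posdefmx S /\ S *m S = invmx A].

Definition frobenius (A : 'M[R]_q) : R :=
  Num.sqrt (\sum_(k < q) \sum_(l < q) A k l ^+ 2).

End matrices.


(* An observation is w = ((x, y), z) with x, y : R and z in R^d. *)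
Notation Zvec R d := (d.-tuple (measurableTypeR R)).
Notation Obs R d := (measurableTypeR R * measurableTypeR R * Zvec R d)%type.

Section model.
Context (R : realType) (d : nat).
Implicit Types (P : probability (Obs R d) R) (z : Zvec R d) (t tau : R).

Definition obsX (w : Obs R d) : R := w.1.1.
Definition obsY (w : Obs R d) : R := w.1.2.
Definition obsZ (w : Obs R d) : Zvec R d := w.2.

Definition cube : set (Zvec R d) :=
  [set z | forall i, (tnth z i : R) \in `[0, 1]].

Definition obs_cube : set (Obs R d) :=
  [set w | [/\ obsX w \in `[0, 1], obsY w \in `[0, 1] & cube (obsZ w)]].

(* Lebesgue measure on [0,1], i.e. the uniform probability. *)
Definition leb01 : probability (measurableTypeR R) R :=
  uniform_prob (@ltr01 R).

(* Lebesgue measure on [0,1]^{2+d}. *)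
Definition leb_cube : probability (Obs R d) R :=
  ((leb01 \x leb01) \x iid leb01 d)%E.

Definition calP : set (probability (Obs R d) R) :=
  [set P | P obs_cube = 1%E /\ P `<< leb_cube].

(* z |-> f z is a version of the conditional probability P(E | Z = z). *)
Definition is_cond_prob P (E : set (Obs R d)) (f : Zvec R d -> \bar R) : Prop :=
  [/\ measurable_fun setT f,
      forall z, (0 <= f z)%E
    & forall C, measurable C ->
        P (E `&` obsZ @^-1` C) = (\int[P]_(w in obsZ @^-1` C) f (obsZ w))%E].

(* P(X \in A, Y \in B | Z) = P(X \in A | Z) P(Y \in B | Z) almost surely. *)
Definition cond_indep P : Prop :=
  forall A B : set (measurableTypeR R), measurable A -> measurable B ->
  forall fA fB : Zvec R d -> \bar R,
    is_cond_prob P (obsX @^-1` A) fA ->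
    is_cond_prob P (obsY @^-1` B) fB ->
    is_cond_prob P (obsX @^-1` A `&` obsY @^-1` B) (fun z => fA z * fB z)%E.

Definition calH : set (probability (Obs R d) R) :=
  [set P | calP P /\ cond_indep P].

(* F(t|z) and Q(tau|z) for a conditional distribution k of X (or Y) given Z. *)
Definition cond_cdf (k : R.-pker (Zvec R d) ~> measurableTypeR R) t z : R :=
  fine (k z `]-oo, t]%classic).

Definition cond_qf (k : R.-pker (Zvec R d) ~> measurableTypeR R) tau z : R :=
  inf [set t | t \in `[0, 1] /\ tau <= cond_cdf k t z].

(* k is a regular conditional distribution on [0,1] of V given Z which is
   continuous (atomless) for every z, not merely for almost every z. *)
Definition cont_cond_dist P (V : Obs R d -> R)
    (k : R.-pker (Zvec R d) ~> measurableTypeR R) : Prop :=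
  [/\ forall A : set (measurableTypeR R), measurable A ->
        is_cond_prob P (V @^-1` A) (fun z => k z A),
      forall z, cube z -> k z `[0, 1]%classic = 1%E
    & forall z, cube z -> continuous (fun t : R => cond_cdf k t z)].

(* X_n \in O_M(a_n), X_n being a statistic of a sample of size n >= 1 which may
   also depend on P.  Suprema over z in [0,1]^d need not be measurable, hence
   the outer measure ( ^* ), which agrees with the law on measurable events. *)
Definition stochO (M : set (probability (Obs R d) R))
    (X : forall n, probability (Obs R d) R -> n.-tuple (Obs R d) -> \bar R)
    (a : nat -> R) : Prop :=
  forall eps : R, 0 < eps -> exists2 K : R, 0 < K &
    (ereal_sup [set p | exists n P, [/\ (0 < n)%N, M P &
       p = ((iid P n)^* [set s | K%:E < `|X n P s * (a n)^-1%:E|])%mu]]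
     < eps%:E)%E.

(* sup over z in [0,1]^d of the sup of |f(., z)| over the slice D z *)
Definition slice_norm (D : Zvec R d -> set R) (f : R -> Zvec R d -> R) : \bar R :=
  ereal_sup [set ereal_sup [set `|f t z|%:E | t in D z] | z in cube].

Definition Qint (k : R.-pker (Zvec R d) ~> measurableTypeR R) (a b : R) z : set R :=
  `[cond_qf k a z, cond_qf k b z]%classic.

Definition normT k a b (f : R -> Zvec R d -> R) : \bar R :=
  slice_norm (Qint k a b) f.

Definition normTc k a b (f : R -> Zvec R d -> R) : \bar R :=
  slice_norm (fun z => `[0, 1]%classic `\` Qint k a b z) f.

(* One fitted conditional distribution function for each sample size and each
   sample of (X, Z) (resp. (Y, Z)). *)
Definition estimator : Type :=
  forall n, n.-tuple (measurableTypeR R * Zvec R d) -> R -> Zvec R d -> R.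

(* Values outside the unit cube are irrelevant.  The last clause says that the
   fitted values are random variables. *)
Definition is_estimator (F : estimator) : Prop :=
  forall n, (0 < n)%N ->
  (forall s : n.-tuple (measurableTypeR R * Zvec R d),
    (forall i, ((tnth s i).1 : R) \in `[0, 1] /\ cube (tnth s i).2) ->
    forall z, cube z ->
      [/\ forall t, t \in `[0, 1] -> F n s t z \in `[0, 1],
          {within `[0, 1]%classic, continuous (fun t => F n s t z)},
          {in `[0, 1] &, {homo (fun t => F n s t z) : t u / t <= u}},
          F n s 0 z = 0
        & F n s 1 z = 1]) /\
  (forall i : 'I_n,
    measurable_fun [set: n.-tuple (measurableTypeR R * Zvec R d)]
      (fun s => F n s (tnth s i).1 (tnth s i).2)).

Definition sampleXZ n (s : n.-tuple (Obs R d)) :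
    n.-tuple (measurableTypeR R * Zvec R d) :=
  [tuple of [seq (obsX w, obsZ w) | w <- s]].

Definition sampleYZ n (s : n.-tuple (Obs R d)) :
    n.-tuple (measurableTypeR R * Zvec R d) :=
  [tuple of [seq (obsY w, obsZ w) | w <- s]].

End model.

Section score.
Context (R : realType) (q : nat).
Notation mu := (@lebesgue_measure R).
Implicit Type phi : R -> 'cV[R]_q.

Definition supp phi (k : 'I_q) : set R := closure [set u | phi u k 0 != 0].

(* phi : [0,1] -> R^q is extended by 0 outside [0,1], as forced by the first
   clause. *)
Definition is_score phi : Prop :=
  [/\ forall k, compact (supp phi k) /\ supp phi k `<=` `]0, 1[%classic,
      forall k, [lipschitz phi u k 0 | u in `[0, 1]%classic],
      forall k, \int[mu]_(u in `[0, 1]) phi u k 0 = 0,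
      forall k, \int[mu]_(u in `[0, 1]) (phi u k 0 ^+ 2) = 1
    & forall c : 'rV[R]_q,
        (forall u, u \in `[0, 1] -> c *m phi u = 0) -> c = 0].

Definition tau_min phi : R := inf (\bigcup_k supp phi k).
Definition tau_max phi : R := sup (\bigcup_k supp phi k).

Definition Sigma phi : 'M[R]_q :=
  \matrix_(k, s) \int[mu]_(u in `[0, 1]) (phi u k 0 * phi u s 0).

End score.

Section test.
Context (R : realType) (d q : nat) (phi : R -> 'cV[R]_q).

Definition rho (P : probability (Obs R d) R)
    (kX kY : R.-pker (Zvec R d) ~> measurableTypeR R) : 'M[R]_q :=
  \matrix_(k, l) fine 'E_P[fun w =>
    (phi (cond_cdf kX (obsX w) (obsZ w)) *m
     (phi (cond_cdf kY (obsY w) (obsZ w)))^T) k l]%E.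

Context (FX FY : estimator R d).

Definition U1hat n (s : n.-tuple (Obs R d)) (i : 'I_n) : R :=
  FX (sampleXZ s) (obsX (tnth s i)) (obsZ (tnth s i)).

Definition U2hat n (s : n.-tuple (Obs R d)) (i : 'I_n) : R :=
  FY (sampleYZ s) (obsY (tnth s i)) (obsZ (tnth s i)).

Definition rhohat n (s : n.-tuple (Obs R d)) : 'M[R]_q :=
  n%:R^-1 *: \sum_(i < n) phi (U1hat s i) *m (phi (U2hat s i))^T.

Definition Tstat n (s : n.-tuple (Obs R d)) : R :=
  frobenius (invsqrtmx (Sigma phi) *m rhohat s *m invsqrtmx (Sigma phi)) ^+ 2.

Definition Psihat (alpha : R) n (s : n.-tuple (Obs R d)) : R :=
  if n%:R^-1 * chi2_quantile (q ^ 2)%N (1 - alpha) < Tstat s then 1 else 0.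

End test.

Definition calA (R : realType) (d q : nat) (phi : R -> 'cV[R]_q)
    (P0 : set (probability (Obs R d) R))
    (kX kY : probability (Obs R d) R -> R.-pker (Zvec R d) ~> measurableTypeR R)
    (lambda : R) : set (probability (Obs R d) R) :=
  (P0 `\` @calH R d) `&`
  [set P | exists k l, lambda < `|rho phi P (kX P) (kY P) k l|].

(* Main.v *)
Require Import Defs.
From HB Require Import structures.
From mathcomp Require Import all_boot all_order all_algebra.
From mathcomp Require Import all_classical all_reals all_analysis.
From mathcomp Require Import measurable_realfun.
From mathcomp Require Import ring lra.
Import Order.TTheory GRing.Theory Num.Theory.
Import numFieldNormedType.Exports.
Local Open Scope classical_set_scope.
Local Open Scope ring_scope.

(** Suppose that rho_P has an entry (k, l) larger than lambda in absolute value.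
The test rejects as soon as T_n exceeds a deterministic quantity of order 1/n,
so it is enough that the entry (k, l) of rhohat stays above lambda / 2 in
absolute value with probability tending to one uniformly in P: T_n is the
squared Frobenius norm of S rhohat S with S invertible, hence bounds every
squared entry of rhohat up to a constant that depends on phi only
([le_sqr_rhohat_Tstat]).

The distance from rhohat to rho_P has two parts.

Replacing the fitted values by the true ranks U_1, U_2 turns rhohat into a mean
of n i.i.d. bounded variables with expectation rho_P; Chebyshev's inequality
([weak_law]) bounds its deviation with constants that involve only n and a
bound for phi, hence uniformly in P.

The replacement itself is deterministic.  If the estimate is within delta of
the conditional distribution function F on the inner band
[Q(tau_min), Q(tau_max)], then phi of the estimate is within L delta of phi of
F on all of [0,1] ([score_fit_close]).  On the band this is the Lipschitz
property.  To the left of the band phi(F) vanishes; the estimate is increasing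
and is at most tau_min + delta at the left end of the band, so at each point to
the left it lies either below tau_min, where phi vanishes, or within delta of
tau_min, where phi is at most L delta.  The right side is symmetric.  By the
rate hypotheses delta can be taken as small as desired outside an event of
small outer probability, uniformly in P. *)

Set Implicit Arguments.
Unset Strict Implicit.

(** * Means of i.i.d. bounded variables *)

Lemma measurable_all_tnth dd (T : measurableType dd) (A : set T) n :
  measurable A -> measurable [set s : n.-tuple T | forall i, A (tnth s i)].
Proof.
move=> mA.
have -> : [set s : n.-tuple T | forall i, A (tnth s i)] =
    \bigcap_(i in [set: 'I_n]) (@tnth _ T ^~ i) @^-1` A.
  by apply/seteqP; split => s As i; [move=> _; exact: As|exact: As].
apply: fin_bigcap_measurable => // i _; rewrite -[X in measurable X]setTI.
exact: measurable_tnth.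
Qed.

Lemma iid_all (R : realType) dd (T : measurableType dd) (P : probability T R)
    (A : set T) n : measurable A -> P A = 1%E ->
  iid P n [set s | forall i, A (tnth s i)] = 1%E.
Proof.
move=> mA PA; elim: n => [|n IH].
  have -> : [set s : 0.-tuple T | forall i, A (tnth s i)] = setT.
    by apply/seteqP; split => s // _ [].
  exact: probability_setT.
have mAn := @measurable_all_tnth _ _ A n mA.
rewrite /= /distribution /pushforward /=.
rewrite [X in product_measure1 _ _ X](_ : _ = A `*` [set s | forall i, A (tnth s i)]).
  by rewrite product_measure1E//; exact: (etrans (congr2 mule PA IH) (mule1 _)).
apply/seteqP; split=> -[w s] /= => [As|[Aw As] i].
  by split=> [|i]; [have := As ord0|have := As (lift ord0 i)]; rewrite ?tnth0 ?tnthS.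
by case: (unliftP ord0 i) => [j ->|->]; rewrite ?tnth0 ?tnthS.
Qed.

Lemma integral_cst_prob (R : realType) dd (T : measurableType dd)
  (Q : probability T R) (c : R) : (\int[Q]_w c%:E = c%:E)%E.
Proof. by have := expectation_cst Q c; rewrite unlock. Qed.

Section sums_of_iid.
Context (R : realType) dd (T : measurableType dd) (P : probability T R).
Implicit Types (f : T -> R).

Lemma bounded_integrable (Q : probability T R) f (C : R) :
  measurable_fun setT f -> (forall w, `|f w| <= C) -> Q.-integrable setT (EFin \o f).
Proof.
move=> mf fC; apply: measurable_bounded_integrable => //.
  by rewrite -ge0_fin_numE// fin_num_measure.
by exists C; split; [exact: num_real|] => M CM x _; apply: (le_trans (fC x)); exact: ltW.
Qed.

(** One step of the variance computation: the cross term 2 b f integrates to zero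
because f is centered. *)
Lemma second_moment_shift f (C b : R) :
  measurable_fun setT f -> (forall w, `|f w| <= C) -> (\int[P]_w (f w)%:E = 0)%E ->
  (\int[P]_w ((f w + b) ^+ 2)%:E <= (C ^+ 2 + b ^+ 2)%:E)%E.
Proof.
move=> mf fC f0; have If := @bounded_integrable P f C mf fC.
have Ic : P.-integrable setT (EFin \o cst (C ^+ 2 + b ^+ 2) : T -> \bar R).
  by apply: finite_measure_integrable_cst.
apply: (@le_trans _ _ (\int[P]_w ((C ^+ 2 + b ^+ 2)%:E + (2 * b)%:E * (f w)%:E))%E).
  apply: ge0_le_integral => //.
  - by move=> x _; rewrite lee_fin sqr_ge0.
  - by apply/measurable_EFinP; apply: measurable_funX; apply: measurable_funD.
  - apply: emeasurable_funD => //; apply: emeasurable_funM => //.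
    exact/measurable_EFinP.
  move=> x _; rewrite -EFinM -EFinD lee_fin.
  have := fC x; rewrite ler_norml => /andP[h1 h2]; nra.
rewrite integralD //; last exact: integrableZl.
by rewrite integralZl// f0 mule0 adde0 integral_cst_prob.
Qed.

(** Variances add up.  By Tonelli the newly drawn observation is integrated first,
with the sum of the others playing the role of the constant shift. *)
Lemma iid_second_moment f (C : R) n :
  measurable_fun setT f -> (forall w, `|f w| <= C) -> (\int[P]_w (f w)%:E = 0)%E ->
  (\int[iid P n]_s ((\sum_(i < n) f (tnth s i)) ^+ 2)%:E <= (n%:R * C ^+ 2)%:E)%E.
Proof.
move=> mf fC f0; elim: n => [|n IH].
  rewrite mul0r; under eq_integral do rewrite big_ord0 expr0n.
  by rewrite integral0.
have mS m : measurable_fun [set: m.-tuple T] (fun s => \sum_(i < m) f (tnth s i)).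
  apply: measurable_sum => i; apply: measurableT_comp => //; exact: measurable_tnth.
rewrite ge0_integral_distribution; last 2 first.
- by apply/measurable_EFinP; exact: (measurable_funX 2 (mS n.+1)).
- by move=> y; rewrite lee_fin sqr_ge0.
under eq_integral.
  move=> w _; rewrite /= big_ord_recl tnth0.
  under eq_bigr do rewrite tnthS.
  over.
have mF : measurable_fun [set: T * n.-tuple T]
    (fun x => ((f x.1 + \sum_(i < n) f (tnth x.2 i)) ^+ 2)%:E).
  apply/measurable_EFinP; apply: measurable_funX; apply: measurable_funD.
    exact: measurableT_comp.
  by apply: (measurableT_comp (mS n)).
rewrite /= fubini_tonelli2; last 2 first.
- exact: mF.
- by move=> y; rewrite lee_fin sqr_ge0.
apply: (@le_trans _ _ (\int[iid P n]_s
    ((C ^+ 2)%:E + ((\sum_(i < n) f (tnth s i)) ^+ 2)%:E))%E).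
  apply: ge0_le_integral => //.
  - by move=> x _; apply: integral_ge0 => y _; rewrite lee_fin sqr_ge0.
  - apply: measurable_fun_fubini_tonelli_G => //.
      by move=> y; rewrite lee_fin sqr_ge0.
  - apply: emeasurable_funD => //.
    by apply/measurable_EFinP; exact: (measurable_funX 2 (mS n)).
  by move=> s _; rewrite /fubini_G/= second_moment_shift.
rewrite ge0_integralD//; first last.
- by apply/measurable_EFinP; exact: (measurable_funX 2 (mS n)).
- by move=> x _; rewrite lee_fin sqr_ge0.
- by move=> x _; rewrite lee_fin sqr_ge0.
rewrite integral_cst_prob.
rewrite -natr1 mulrDl mul1r EFinD addeC; exact: (leeD IH (lexx _)).
Qed.

Lemma measurable_mean_deviation f n (m eta : R) : measurable_fun setT f ->
  measurable [set s : n.-tuple T |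
    eta <= `|n%:R^-1 * \sum_(i < n) f (tnth s i) - m|].
Proof.
move=> mf; rewrite -[X in measurable X]setTI; apply: measurable_fun_le => //.
apply: measurableT_comp => //; apply: measurable_funB => //.
apply: measurable_funM => //.
apply: measurable_sum => i; apply: measurableT_comp => //; exact: measurable_tnth.
Qed.

(** Chebyshev's inequality.  Its bound is free of P, which makes the law of large
numbers uniform over a class of distributions. *)
Lemma weak_law f (C : R) n (eta : R) : (0 < n)%N -> 0 < eta ->
  measurable_fun setT f -> (forall w, `|f w| <= C) ->
  (iid P n [set s | (eta <= `|n%:R^-1 * \sum_(i < n) f (tnth s i) - fine 'E_P[f]|)%R] <=
   ((2 * C) ^+ 2 / (n%:R * eta ^+ 2))%:E)%E.
Proof.
move=> n0 eta0 mf fC; have If := @bounded_integrable P f C mf fC.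
set m := fine _.
have Em : (\int[P]_w (f w)%:E = m%:E)%E.
  by rewrite /m unlock fineK//; exact: integrable_fin_num.
have mC : `|m| <= C.
  rewrite -lee_fin -[(`|m|%:E)%E]/(`|m%:E|)%E -Em.
  apply: (le_trans (le_abse_integral _ _ _)) => //; first exact/measurable_EFinP.
  apply: (@le_trans _ _ (\int[P]_x (cst C%:E x))%E).
    apply: ge0_le_integral => //; last by move=> x _; rewrite /= lee_fin.
    by apply: measurableT_comp => //; exact/measurable_EFinP.
  by rewrite integral_cst_prob.
pose g w := f w - m.
have mg : measurable_fun setT g by apply: measurable_funB.
have gC w : `|g w| <= 2 * C.
  by rewrite (le_trans (ler_normB _ _))// mulr_natl mulr2n lerD.
have g0 : (\int[P]_w (g w)%:E = 0)%E.
  rewrite /g; under eq_integral do rewrite EFinB.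
  rewrite integralB_EFin//; last by apply: finite_measure_integrable_cst.
  by rewrite Em integral_cst_prob subee.
have H := @iid_second_moment g (2 * C) n mg gC g0.
have nR0 : 0 < n%:R :> R by rewrite ltr0n.
have mS : measurable_fun setT (fun s : n.-tuple T => \sum_(i < n) g (tnth s i)).
  apply: measurable_sum => i; apply: measurableT_comp => //; exact: measurable_tnth.
set A := [set s | _].
have A_moment s : A s -> (n%:R * eta) ^+ 2 <= (\sum_(i < n) g (tnth s i)) ^+ 2.
  rewrite /A /= sumrB sumr_const card_ord => h.
  rewrite -[leRHS]real_normK ?num_real// lerXn2r ?nnegrE ?mulr_ge0// ?(ltW nR0) ?(ltW eta0)//.
  rewrite -[m *+ n]mulr_natl -(ler_pM2l (x := n%:R^-1)) ?invr_gt0//.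
  rewrite mulKf ?gt_eqF// -[X in X * `|_|]ger0_norm ?invr_ge0// -normrM mulrBr.
  by rewrite mulKf ?gt_eqF.
have mA : measurable A by exact: measurable_mean_deviation.
have : (((n%:R * eta) ^+ 2)%:E * iid P n A <= (n%:R * (2 * C) ^+ 2)%:E)%E.
  apply: le_trans H; rewrite -[A in iid P n A]setIT -integral_indic//.
  rewrite -ge0_integralZl//; first last.
  - by rewrite lee_fin sqr_ge0.
  - by apply/measurable_EFinP; exact: measurable_indic.
  apply: ge0_le_integral => //.
  - by move=> s _; rewrite -EFinM lee_fin mulr_ge0// sqr_ge0.
  - apply: emeasurable_funM => //.
    by apply/measurable_EFinP; exact: measurable_indic.
  - by apply/measurable_EFinP; exact: measurable_funX.
  move=> s _; rewrite -EFinM lee_fin indicE.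
  have [As|As] := boolP (s \in A); last by rewrite mulr0 sqr_ge0.
  by rewrite mulr1 A_moment// -inE.
rewrite -[iid P n A]fineK ?fin_num_measure//.
rewrite -EFinM !lee_fin => h.
rewrite ler_pdivlMr ?mulr_gt0 ?exprn_gt0//.
rewrite -(ler_pM2l nR0); apply: le_trans h; lra.
Qed.
End sums_of_iid.

(** * Score functions *)

Section score_functions.
Context (R : realType) (q : nat) (phi : R -> 'cV[R]_q).
Hypothesis phi_score : is_score phi.

Lemma score_support k u : phi u k 0 != 0 -> supp phi k u.
Proof. by move=> h; apply: (@subset_closure _ [set u | phi u k 0 != 0]). Qed.

Lemma score_outside k u : ~~ (0 < u < 1) -> phi u k 0 = 0.
Proof.
case: phi_score => supp01 _ _ _ _.
move=> u01; apply/eqP; apply: contraNT u01 => /score_support.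
by case: (supp01 k) => _ /[apply]; rewrite /= in_itv.
Qed.

(** The Lipschitz property on [0,1] extends to the whole line because phi vanishes
off ]0, 1[: clamping to [0,1] is 1-Lipschitz and does not change phi. *)
Lemma score_lipschitz :
  exists2 L : R, 0 < L & forall k u v, `|phi u k 0 - phi v k 0| <= L * `|u - v|.
Proof.
case: (phi_score) => _ lip _ _ _.
have [M [Mr HM]] : \forall M \near +oo, forall k,
    M.-lipschitz_[set` `[0 : R, 1]] (fun u => phi u k 0).
  apply: filter_forall => k; exact: lip.
exists (Num.max 1 (M + 1)); first by rewrite lt_max ltr01.
set L := Num.max _ _; have L0 : 0 < L by rewrite lt_max ltr01.
have ML : M < L by rewrite lt_max ltrDl ltr01 orbT.
have L01 k u v : 0 <= u <= 1 -> 0 <= v <= 1 ->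
    `|phi u k 0 - phi v k 0| <= L * `|u - v|.
  by move=> hu hv; apply: (HM L ML k (u, v)); split; rewrite /= in_itv.
pose c (u : R) := Num.max 0 (Num.min u 1).
have c01 u : 0 <= c u <= 1.
  by rewrite /c le_max lexx /= ge_max ler01 /= ge_min lexx orbT.
have phic k u : phi u k 0 = phi (c u) k 0.
  have [u0|u0] := leP u 0.
    have -> : c u = 0 by rewrite /c; apply/max_idPl; rewrite ge_min u0.
    by rewrite !score_outside// ?ltxx// ltNge u0.
  have [u1|u1] := leP u 1.
    by rewrite /c (min_idPl u1) (max_idPr (ltW u0)).
  rewrite /c (min_idPr (ltW u1)) (max_idPr ler01).
  by rewrite !score_outside// ?ltxx ?andbF// [u < 1]ltNge (ltW u1) andbF.
move=> k u v; rewrite phic (phic k v).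
apply: (le_trans (L01 k _ _ (c01 u) (c01 v))); rewrite ler_pM2l//.
have uv1 := ler_norm (u - v); have uv2 := ler_norm (v - u).
rewrite distrC in uv2; rewrite ler_norml /c.
by case: (leP u 1) => ?; case: (leP v 1) => ?; case: (leP 0 u) => ?;
  case: (leP 0 v) => ?; case: (leP (0 : R) 1) => ?; lra.
Qed.

Lemma score_nonempty : (0 < q)%N -> (\bigcup_k supp phi k) !=set0.
Proof.
move=> q0; apply/set0P/negP => /eqP H.
case: phi_score => _ _ _ nrm _; have := nrm (Ordinal q0).
have phi0 u : phi u (Ordinal q0) 0 = 0.
  apply/eqP; apply: contraT => /score_support h.
  suff : set0 u by [].
  by rewrite -H; exists (Ordinal q0).
under eq_Rintegral do rewrite phi0 expr0n.
by rewrite Rintegral_cst// mul0r => /esym/eqP; rewrite oner_eq0.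
Qed.

Lemma bigcup_supp01 u : (\bigcup_k supp phi k) u -> 0 < u < 1.
Proof.
case: phi_score => supp01 _ _ _ _ [k _].
by case: (supp01 k) => _ /[apply]; rewrite /= in_itv.
Qed.

Lemma score_range : (0 < q)%N ->
  0 <= tau_min phi /\ tau_min phi <= tau_max phi /\ tau_max phi <= 1.
Proof.
move=> q0; have [u Su] := score_nonempty q0.
have lb : has_inf (\bigcup_k supp phi k).
  by split; [exists u|exists 0 => v /bigcup_supp01/andP[/ltW]].
have ub : has_sup (\bigcup_k supp phi k).
  by split; [exists u|exists 1 => v /bigcup_supp01/andP[_ /ltW]].
split; first by apply: lb_le_inf; [exists u|move=> v /bigcup_supp01/andP[/ltW]].
split; last by apply: ge_sup; [exists u|move=> v /bigcup_supp01/andP[_ /ltW]].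
apply: (@le_trans _ _ u); first by apply: ge_inf => //; case: lb.
by apply: sup_upper_bound.
Qed.

Lemma score_strictly_outside k u : u < tau_min phi \/ tau_max phi < u ->
  phi u k 0 = 0.
Proof.
move=> h; apply/eqP; apply: contraPT h => /score_support Su.
have SU : (\bigcup_k supp phi k) u by exists k.
case; apply/negP; rewrite -leNgt.
  apply: ge_inf => //; by exists 0 => v /bigcup_supp01/andP[/ltW].
apply: sup_upper_bound => //; split; first by exists u.
by exists 1 => v /bigcup_supp01/andP[_ /ltW].
Qed.

(** phi vanishes also at tau_min and tau_max themselves, as a limit of zeros of a
continuous function. *)
Lemma score_tails k u : u <= tau_min phi \/ tau_max phi <= u -> phi u k 0 = 0.
Proof.
have [L L0 lip] := score_lipschitz.
move=> h; apply/eqP; rewrite -normr_le0; apply/ler_addgt0Pr => e e0.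
pose d := e / L; have d0 : 0 < d by rewrite divr_gt0.
have [v [v0 uv]] : exists v, phi v k 0 = 0 /\ `|u - v| <= d.
  case: h => h; [exists (u - d)|exists (u + d)]; split.
  - by apply: score_strictly_outside; left; rewrite ltrBlDr (le_lt_trans h)// ltrDl.
  - by rewrite subKr ger0_norm// ltW.
  - by apply: score_strictly_outside; right; rewrite (le_lt_trans h)// ltrDl.
  - by rewrite opprD addNKr normrN ger0_norm// ltW.
rewrite add0r -[phi u k 0]subr0 -v0 (le_trans (lip _ _ _))//.
by rewrite -ler_pdivlMl// mulrC.
Qed.

Lemma measurable_score k : measurable_fun setT (fun u : measurableTypeR R => phi u k 0).
Proof.
have [L L0 lip] := score_lipschitz.
apply: continuous_measurable_fun => u; apply/cvgrPdist_le => e e0.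
near=> v; apply: (le_trans (lip _ _ _)); rewrite -ler_pdivlMl// mulrC.
near: v; apply: cvgr_dist_le; [exact: cvg_id|exact: divr_gt0].
Unshelve. all: by end_near. Qed.

End score_functions.

(** * Conditional distribution functions and their quantiles *)

Section conditional_cdf.
Context (R : realType) (d : nat) (k : R.-pker (Zvec R d) ~> measurableTypeR R).

(** The kernel k with a dummy real parameter: the parameter is the point t at which
the distribution function is evaluated, so that joint measurability of
(t, z) |-> F(t|z) becomes measurability of the mass of a section. *)
Definition kernel_snd (w : measurableTypeR R * Zvec R d) :
  {measure set (measurableTypeR R) -> \bar R} := k w.2.

Let measurable_kernel_snd U : measurable U ->
  measurable_fun setT (kernel_snd ^~ U).
Proof.
by move=> mU; apply: (measurableT_comp (measurable_kernel k U mU)).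
Qed.

HB.instance Definition _ :=
  isKernel.Build _ _ _ _ R kernel_snd measurable_kernel_snd.

Let kernel_snd_setT w : kernel_snd w setT = 1%E.
Proof. exact: prob_kernel. Qed.

HB.instance Definition _ :=
  Kernel_isProbability.Build _ _ _ _ R kernel_snd kernel_snd_setT.

Lemma measurable_cond_cdf :
  measurable_fun setT (fun w : measurableTypeR R * Zvec R d => cond_cdf k w.1 w.2).
Proof.
pose A : set ((measurableTypeR R * Zvec R d) * measurableTypeR R) :=
  [set x | (x.2 : R) <= x.1.1].
have mA : measurable A.
  rewrite -[A]setTI; apply: measurable_fun_le => //.
  by apply: (measurableT_comp (measurable_fst)).
have := @measurable_fun_xsection_finite_kernel _ _ _ _ R
   [the R.-fker _ ~> _ of kernel_snd] A (mem_set mA).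
move=> /(measurableT_comp (@fine_measurable R setT measurableT)).
apply: eq_measurable_fun => w _ /=; rewrite /cond_cdf /kernel_snd; congr (fine (k _ _)).
by apply/seteqP; split => t; rewrite /= in_itv /= /xsection /= inE.
Qed.

Lemma cond_cdf_mono z : {homo (fun t => cond_cdf k t z) : t u / t <= u}.
Proof.
move=> t u tu; have fin v : k z `]-oo, v]%classic \is a fin_num.
  by apply: kernel_finite_transition.
apply: (fine_le (fin _) (fin _)).
by apply: (@le_measure _ _ _ (k z)); rewrite ?inE//; apply: subset_itvl; rewrite bnd_simp.
Qed.

Section at_a_point.
Variable z : Zvec R d.
Hypothesis k01 : k z `[0, 1]%classic = 1%E.
Hypothesis kcont : continuous (fun t : R => cond_cdf k t z).

Lemma cond_cdf1 : cond_cdf k 1 z = 1.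
Proof.
have le1 : (k z `]-oo, 1%R]%classic <= 1)%E.
  by rewrite -(prob_kernel (s := k) z); apply: (@le_measure _ _ _ (k z)); rewrite ?inE.
have ge1 : (1 <= k z `]-oo, 1%R]%classic)%E.
  rewrite -{1}k01; apply: (@le_measure _ _ _ (k z)); rewrite ?inE//.
  by move=> t /=; rewrite !in_itv/= => /andP[].
by rewrite /cond_cdf (le_anti (introT andP (conj le1 ge1))).
Qed.

(** There is no mass on the negative axis, and continuity of F excludes an atom at
zero. *)
Lemma cond_cdf0 : cond_cdf k 0 z = 0.
Proof.
have neg (t : R) : t < 0 -> cond_cdf k t z = 0.
  move=> t0; have -> : 0 = fine (0%E : \bar R) by [].
  congr fine; apply/eqP; rewrite eq_le measure_ge0 andbT.
  have <- : k z (~` `[0, 1]%classic) = 0%E.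
    have h : k z (`[0 : R, 1]%classic `|` ~` `[0 : R, 1]%classic) = 1%E.
      by rewrite setUv; exact: prob_kernel.
    rewrite (@measureU _ _ _ (k z)) ?setICr// in h; last exact: measurableC.
    have fin := kernel_finite_transition (s := k) z _ (measurableC (measurable_itv `[0 : R, 1])).
    move: (etrans (esym (congr1 (fun x => x + _)%E k01)) h).
    rewrite -[X in (_ + X)%E](fineK fin) -EFinD => -[h1].
    by rewrite -(fineK fin); congr EFin; lra.
  apply: (@le_measure _ _ _ (k z)); rewrite ?inE//; first exact: measurableC.
  by move=> u /=; rewrite !in_itv /= => ut /andP[u0 _]; lra.
apply/eqP; rewrite -normr_le0; apply/ler_addgt0Pr => e e0; rewrite add0r.
have /cvgrPdist_le/(_ e e0)/nbhs_ballP[r/= r0 H] := @kcont 0.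
have := H (- (r / 2)); rewrite /ball /= (neg (- (r / 2))) ?subr0; last by lra.
by apply; rewrite opprK add0r gtr0_norm; lra.
Qed.

Variable tau : R.
Hypothesis tau01 : 0 <= tau <= 1.
Let S := [set t : R | t \in `[0, 1] /\ tau <= cond_cdf k t z].
Let S1 : S 1.
Proof. by split; rewrite ?in_itv /= ?lexx ?ler01// cond_cdf1; case/andP: tau01. Qed.
Let S_inf : has_inf S.
Proof. by split; [exists 1|exists 0 => t [/itvP->]]. Qed.

Lemma cond_qf01 : 0 <= cond_qf k tau z <= 1.
Proof.
apply/andP; split; last by apply: ge_inf => //; case: S_inf.
by apply: lb_le_inf; [exists 1|move=> t [/itvP->]].
Qed.

Lemma lt_cond_qf t : 0 <= t <= 1 -> t < cond_qf k tau z -> cond_cdf k t z < tau.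
Proof.
move=> t01; apply: contraTT; rewrite -!leNgt => h.
by apply: ge_inf; [case: S_inf|split; rewrite ?in_itv].
Qed.

Lemma gt_cond_qf t : cond_qf k tau z < t -> tau <= cond_cdf k t z.
Proof.
move=> /(inf_lt (ex_intro _ _ S1))[u [_ tu] ut].
by apply: (le_trans tu); apply: cond_cdf_mono; apply: ltW.
Qed.

(** F(Q(tau)) <= tau by the intermediate value theorem, since some point of [0,1] has
level exactly tau and Q(tau) lies below it; the converse inequality is the
limit of F(t) >= tau as t decreases to Q(tau). *)
Lemma cond_cdf_qf : cond_cdf k (cond_qf k tau z) z = tau.
Proof.
apply/eqP; rewrite eq_le; apply/andP; split.
  have [|||c c01 Fc] := @IVT R (fun t => cond_cdf k t z) 0 1 tau.
  - exact: ler01.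
  - exact: continuous_subspaceT.
  - by rewrite cond_cdf0 cond_cdf1 (min_idPl ler01) (max_idPr ler01).
  by rewrite -[leRHS]Fc; apply: cond_cdf_mono; apply: ge_inf;
    [case: S_inf|split; rewrite ?Fc].
apply/ler_addgt0Pr => e e0.
have /cvgrPdist_le/(_ e e0)/nbhs_ballP[r/= r0 H] := @kcont (cond_qf k tau z).
have /H : ball (cond_qf k tau z) r (cond_qf k tau z + r / 2).
  by rewrite /ball /= opprD addNKr normrN gtr0_norm; lra.
have := @gt_cond_qf (cond_qf k tau z + r / 2).
rewrite ltrDl divr_gt0// => /(_ isT) h.
by rewrite ler_norml => /andP[h1 h2]; lra.
Qed.

End at_a_point.

Lemma cond_qf_mono z (a b : R) : k z `[0, 1]%classic = 1%E ->
  b <= 1 -> a <= b -> cond_qf k a z <= cond_qf k b z.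
Proof.
move=> k01 b1 ab; apply: lb_le_inf.
  by exists 1; split; rewrite ?in_itv /= ?lexx ?ler01// cond_cdf1.
move=> t [t01 bt]; apply: ge_inf; first by exists 0 => u [/itvP->].
by split => //; exact: le_trans bt.
Qed.

End conditional_cdf.

(** * The test statistic dominates the entries of the correlation matrix *)

Section matrices_aux.
Context (R : realType) (q : nat).

Lemma posdefmx_unit (S : 'M[R]_q) : posdefmx S -> S \in unitmx.
Proof.
move=> [_ pos]; rewrite -row_free_unit -kermx_eq0; apply: contraT.
move=> /rowV0Pn[v /sub_kermxP vS v0].
by have := pos v v0; rewrite vS mul0mx mxE ltxx.
Qed.

(** [invsqrtmx A] is either positive definite or the identity matrix. *)
Lemma invsqrtmx_unit (A : 'M[R]_q) : invsqrtmx A \in unitmx.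
Proof.
rewrite /invsqrtmx; case: xgetP => [S _ [/posdefmx_unit //]|_]; exact: unitmx1.
Qed.

Lemma frobenius_sqr (A : 'M[R]_q) :
  frobenius A ^+ 2 = \sum_(k < q) \sum_(l < q) A k l ^+ 2.
Proof.
by rewrite sqr_sqrtr// sumr_ge0// => k _; rewrite sumr_ge0// => l _; rewrite sqr_ge0.
Qed.

Lemma le_frobenius (A : 'M[R]_q) k l : `|A k l| <= frobenius A.
Proof.
rewrite -(ler_pXn2r (_ : 0 < 2)%N) ?nnegrE ?sqrtr_ge0//.
rewrite frobenius_sqr real_normK ?num_real// (bigD1 k)//= (bigD1 l)//= -addrA.
rewrite lerDl addr_ge0// ?sumr_ge0// => i _; rewrite ?sqr_ge0//.
by rewrite sumr_ge0// => j _; rewrite sqr_ge0.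
Qed.

(** M is recovered from S M S by multiplying with the inverse of S on both sides;
the constant is the squared sum of the absolute entries of that inverse,
increased by 1 to make it positive. *)
Lemma entry_le_frobenius_sandwich (S : 'M[R]_q) : S \in unitmx ->
  exists2 c : R, 0 < c &
    forall (M : 'M[R]_q) k l, `|M k l| <= c * frobenius (S *m M *m S).
Proof.
move=> uS; pose V := invmx S; pose c := \sum_i \sum_j `|V i j|.
have c0 : 0 <= c by rewrite sumr_ge0// => i _; rewrite sumr_ge0.
have row_c i : \sum_j `|V i j| <= c.
  by rewrite /c [leRHS](bigD1 i)//= lerDl sumr_ge0// => j _; rewrite sumr_ge0.
have col_c j : \sum_i `|V i j| <= c.
  rewrite /c ler_sum// => i _; rewrite [leRHS](bigD1 j)//= lerDl sumr_ge0//.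
exists (1 + c ^+ 2); first by rewrite ltr_pwDl// sqr_ge0.
move=> M k l; set N := S *m M *m S.
have -> : M = V *m N *m V by rewrite /N !mulmxA mulVmx// mul1mx mulmxK.
set f := frobenius N; have f0 : 0 <= f by exact: sqrtr_ge0.
have VN i j : `|(V *m N) i j| <= c * f.
  rewrite mxE (le_trans (ler_norm_sum _ _ _))//.
  apply: (@le_trans _ _ (\sum_m `|V i m| * f)).
    by apply: ler_sum => m _; rewrite normrM ler_wpM2l// le_frobenius.
  by rewrite -mulr_suml ler_wpM2r.
rewrite mxE (le_trans (ler_norm_sum _ _ _))//.
apply: (@le_trans _ _ (\sum_m (c * f) * `|V m l|)).
  by apply: ler_sum => m _; rewrite normrM ler_wpM2r.
rewrite -mulr_sumr; have cf0 : 0 <= c * f by rewrite mulr_ge0.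
by have := ler_wpM2l cf0 (col_c l); nra.
Qed.

End matrices_aux.

(** * From fitted values to scores *)

Section scores_of_fitted_values.
Context (R : realType) (q d : nat) (phi : R -> 'cV[R]_q).
Hypotheses (q_gt0 : (0 < q)%N) (phi_score : is_score phi).
Variable L : R.
Hypotheses (L0 : 0 < L)
  (lip : forall k u v, `|phi u k 0 - phi v k 0| <= L * `|u - v|).

Lemma score_bounded k u : `|phi u k 0| <= L.
Proof.
have [u01|u01] := boolP (0 < u < 1); last first.
  by rewrite (score_outside phi_score)// normr0 ltW.
have -> : phi u k 0 = phi u k 0 - phi 0 k 0.
  by rewrite [phi 0 k 0](score_outside phi_score) ?subr0// ltxx.
case/andP: u01 => u0 u1.
by rewrite (le_trans (lip _ _ _))// subr0 gtr0_norm// ger_pMr// ltW.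
Qed.

Lemma score_product_close k l (u u' v v' a b : R) :
  `|phi u k 0 - phi u' k 0| <= L * a -> `|phi v l 0 - phi v' l 0| <= L * b ->
  `|phi u k 0 * phi v l 0 - phi u' k 0 * phi v' l 0| <= L ^+ 2 * (a + b).
Proof.
move=> ha hb.
have -> : phi u k 0 * phi v l 0 - phi u' k 0 * phi v' l 0 =
  (phi u k 0 - phi u' k 0) * phi v l 0 + phi u' k 0 * (phi v l 0 - phi v' l 0).
  by ring.
rewrite (le_trans (ler_normD _ _))// !normrM.
have -> : L ^+ 2 * (a + b) = L * a * L + L * (L * b) by ring.
by apply: lerD; apply: ler_pM => //; exact: score_bounded.
Qed.

Variables (k : R.-pker (Zvec R d) ~> measurableTypeR R) (z : Zvec R d).
Hypotheses (k01 : k z `[0, 1]%classic = 1%E)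
  (kcont : continuous (fun t : R => cond_cdf k t z)).

(** Closeness on the inner band alone controls the scores on all of [0,1].  Beyond
the band the score of the true rank is zero, and monotonicity of Fh prevents
the fitted value from re-entering [tau_min, tau_max] by more than delta. *)
Lemma score_fit_close (Fh : R -> R) (delta : R) :
  {in `[0, 1] &, {homo Fh : t u / t <= u}} ->
  (forall t, Qint k (tau_min phi) (tau_max phi) z t ->
     `|cond_cdf k t z - Fh t| <= delta) ->
  forall j (t : R), t \in `[0, 1] ->
    `|phi (Fh t) j 0 - phi (cond_cdf k t z) j 0| <= L * delta.
Proof.
move=> Fh_mono close j t t01.
have [tm0 [tmM tM1]] := score_range phi_score q_gt0.
have tm01 : 0 <= tau_min phi <= 1 by rewrite tm0 (le_trans tmM).
have tM01 : 0 <= tau_max phi <= 1 by rewrite tM1 (le_trans tm0).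
set a := cond_qf k (tau_min phi) z; set b := cond_qf k (tau_max phi) z.
have ab : a <= b by exact: cond_qf_mono.
have a01 : a \in `[0, 1] by rewrite in_itv cond_qf01.
have b01 : b \in `[0, 1] by rewrite in_itv cond_qf01.
have := close a; have := close b; rewrite /Qint /= !in_itv /= -/a -/b !lexx ab.
move=> /(_ isT) cb /(_ isT) ca.
rewrite cond_cdf_qf// ler_distlC in ca.
rewrite cond_cdf_qf// ler_distlC in cb.
case/andP: ca => _ ca; case/andP: cb => cb _.
have delta0 : 0 <= delta by apply: le_trans (close a _); rewrite ?normr_ge0// /Qint /= in_itv /= lexx.
have Ld : 0 <= L * delta by rewrite mulr_ge0// ltW.
have [ta|at_] := ltP t a.
  have h : cond_cdf k t z < tau_min phi by apply: lt_cond_qf ta; move: t01; rewrite in_itv.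
  rewrite [X in _ - X](score_tails phi_score); last by left; exact: ltW.
  have ha : Fh t <= Fh a by apply: Fh_mono => //; exact: ltW.
  have [le_m|lt_m] := leP (Fh t) (tau_min phi).
    by rewrite (score_tails phi_score) ?subr0 ?normr0//; left.
  rewrite -(score_tails phi_score j (u := tau_min phi)); last by left.
  rewrite (le_trans (lip _ _ _))// ler_pM2l// gtr0_norm; lra.
have [tb|bt] := leP t b.
  rewrite (le_trans (lip _ _ _))// ler_pM2l// distrC; apply: close.
  by rewrite /Qint /= in_itv /= at_ tb.
have h : tau_max phi <= cond_cdf k t z by apply: gt_cond_qf bt.
rewrite [X in _ - X](score_tails phi_score); last by right.
have ha : Fh b <= Fh t by apply: Fh_mono => //; exact: ltW.
have [le_m|lt_m] := leP (tau_max phi) (Fh t).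
  by rewrite (score_tails phi_score) ?subr0 ?normr0//; right.
rewrite -(score_tails phi_score j (u := tau_max phi)); last by right.
rewrite (le_trans (lip _ _ _))// ler_pM2l// distrC gtr0_norm; lra.
Qed.

End scores_of_fitted_values.

(** Outside the exceptional event of the stochastic order condition, the supremum
is finite and bounds every value. *)
Lemma slice_norm_bound (R : realType) d (D : Zvec R d -> set R) f (K a : R) :
  a != 0 -> ~ (K%:E < `|slice_norm D f * a^-1%:E|)%E ->
  forall z t, cube z -> D z t -> `|f t z| <= K * `|a|.
Proof.
move=> a0 /negP; rewrite -leNgt abseM => h z t cz Dt.
have le_norm : (`|f t z|%:E <= slice_norm D f)%E.
  apply: (@le_trans _ _ (ereal_sup [set `|f t z|%:E | t in D z])).
    by apply: ereal_sup_ubound; exists t.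
  by apply: ereal_sup_ubound; exists z.
rewrite -ler_pdivrMr ?normr_gt0// -lee_fin (le_trans _ h)// EFinM -normfV.
rewrite gee0_abs; first by rewrite lee_pmul.
by apply: le_trans le_norm; rewrite lee_fin.
Qed.

(** * Measurability and closeness of the statistics *)

Section statistics.
Context (R : realType) (q d : nat) (phi : R -> 'cV[R]_q).
Hypotheses (q_gt0 : (0 < q)%N) (phi_score : is_score phi).

Lemma measurable_obsX : measurable_fun setT (@obsX R d : Obs R d -> measurableTypeR R).
Proof. exact: (measurableT_comp measurable_fst measurable_fst). Qed.

Lemma measurable_obsY : measurable_fun setT (@obsY R d : Obs R d -> measurableTypeR R).
Proof. exact: (measurableT_comp measurable_snd measurable_fst). Qed.

Lemma measurable_obs_cube : measurable (@obs_cube R d).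
Proof.
have mZ : measurable_fun setT (fun w : Obs R d => obsZ w) by exact: measurable_snd.
have -> : @obs_cube R d = (@obsX R d @^-1` `[0, 1]) `&` (@obsY R d @^-1` `[0, 1])
    `&` (@obsZ R d @^-1` (@cube R d)).
  by apply/seteqP; split => w; [case=> ? ? ?|case=> -[? ?] ?].
apply: measurableI; first apply: measurableI; rewrite -[X in measurable X]setTI.
- by apply: measurable_obsX.
- by apply: measurable_obsY.
- apply: mZ => //.
  exact: (@measurable_all_tnth _ (measurableTypeR R) _ d (measurable_itv `[0, 1])).
Qed.

Section one_coordinate.
Variable V : Obs R d -> measurableTypeR R.
Hypothesis mV : measurable_fun setT V.

(** [sampleXZ] and [sampleYZ] are the cases V = X and V = Y, so the two estimators
can be treated at once. *)
Definition pairs n (s : n.-tuple (Obs R d)) :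
    n.-tuple (measurableTypeR R * Zvec R d) :=
  [tuple of [seq (V w, obsZ w) | w <- s]].

Lemma measurable_fitted (F : estimator R d) n (i : 'I_n) : is_estimator F ->
  measurable_fun setT (fun s : n.-tuple (Obs R d) =>
    F n (pairs s) (V (tnth s i)) (obsZ (tnth s i))).
Proof.
move=> estF; have n0 : (0 < n)%N by case: n i => [[]|].
have [_ /(_ i) mF] := estF n n0.
have mp : measurable_fun setT (@pairs n).
  apply/measurable_fun_tnthP => j.
  apply: (@eq_measurable_fun _ _ _ _ _ ((fun w => (V w, obsZ w)) \o (fun s => tnth s j))).
    by move=> s _ /=; rewrite tnth_map.
  apply: measurableT_comp; last exact: measurable_tnth.
  by apply: measurable_fun_pair => //; exact: measurable_snd.
have := measurableT_comp mF mp; apply: eq_measurable_fun => s _ /=.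
by rewrite tnth_map.
Qed.

Lemma measurable_true_rank (k : R.-pker (Zvec R d) ~> measurableTypeR R) :
  measurable_fun setT (fun w : Obs R d => cond_cdf k (V w) (obsZ w)).
Proof.
have mVZ : measurable_fun setT (fun w : Obs R d => (V w, obsZ w)).
  by apply: measurable_fun_pair => //; exact: measurable_snd.
exact: (measurableT_comp (measurable_cond_cdf k) mVZ).
Qed.

(** Monotonicity of the fitted function is only granted for samples in the unit
cube; this is why the almost sure event that all observations lie in the cube
enters the power bound. *)
Lemma fitted_score_close (L : R) (F : estimator R d) P
    (k : R.-pker (Zvec R d) ~> measurableTypeR R) n (s : n.-tuple (Obs R d))
    (K g : R) :
  0 < L -> (forall j u v, `|phi u j 0 - phi v j 0| <= L * `|u - v|) ->
  is_estimator F -> cont_cond_dist P V k -> g != 0 ->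
  (forall i, obs_cube (tnth s i)) -> (forall w, obs_cube w -> 0 <= V w <= 1) ->
  ~ (K%:E < `|normT k (tau_min phi) (tau_max phi)
       (fun t z => (cond_cdf k t z - F n (pairs s) t z)%R) * g^-1%:E|)%E ->
  forall i j, `|phi (F n (pairs s) (V (tnth s i)) (obsZ (tnth s i))) j 0 -
                phi (cond_cdf k (V (tnth s i)) (obsZ (tnth s i))) j 0|
    <= L * (K * `|g|).
Proof.
move=> L0 lip estF [_ k01 kcont] g0 scube V01 /(slice_norm_bound g0) close i j.
have n0 : (0 < n)%N by case: n i s {scube close} => [[]|].
have [] := estF n n0 => /(_ (pairs s)) Fs _.
have pcube l : ((tnth (pairs s) l).1 : R) \in `[0, 1] /\ cube (tnth (pairs s) l).2.
  by rewrite tnth_map /= in_itv V01//; split => //; case: (scube l).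
have cz : cube (obsZ (tnth s i)) by case: (scube i).
have [_ _ Fmono _ _] := Fs pcube _ cz.
apply: (score_fit_close q_gt0 phi_score L0 lip (k01 _ cz) (kcont _ cz) Fmono).
  by move=> t; exact: close.
by rewrite in_itv V01.
Qed.

End one_coordinate.

Context (FX FY : estimator R d).
Hypotheses (estX : is_estimator FX) (estY : is_estimator FY).

Lemma rhohatE n (s : n.-tuple (Obs R d)) k l :
  rhohat phi FX FY s k l =
  n%:R^-1 * \sum_(i < n) phi (U1hat FX s i) k 0 * phi (U2hat FY s i) l 0.
Proof.
rewrite mxE summxE; congr (_ * _); apply: eq_bigr => i _.
by rewrite mxE big_ord1 mxE.
Qed.

Lemma measurable_rhohat n k l :
  measurable_fun setT (fun s : n.-tuple (Obs R d) => rhohat phi FX FY s k l).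
Proof.
under eq_fun do rewrite rhohatE.
apply: measurable_funM => //; apply: measurable_sum => i.
apply: measurable_funM.
  apply: (measurableT_comp (measurable_score phi_score k)).
  exact: (measurable_fitted measurable_obsX).
apply: (measurableT_comp (measurable_score phi_score l)).
exact: (measurable_fitted measurable_obsY).
Qed.

Lemma measurable_Tstat n :
  measurable_fun setT (fun s : n.-tuple (Obs R d) => Tstat phi FX FY s).
Proof.
rewrite /Tstat; set S := invsqrtmx _.
under eq_fun do rewrite frobenius_sqr.
apply: measurable_sum => i; apply: measurable_sum => j; apply: measurable_funX.
under eq_fun do rewrite mxE.
apply: measurable_sum => l; apply: measurable_funM => //.
under eq_fun do rewrite mxE.
by apply: measurable_sum => m; apply: measurable_funM => //; exact: measurable_rhohat.
Qed.

End statistics.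

(** * Uniform power *)

Lemma le_sqr_rhohat_Tstat (R : realType) (q d : nat) (phi : R -> 'cV[R]_q) :
  exists2 c : R, 0 < c & forall (FX FY : estimator R d) n (s : n.-tuple (Obs R d)) k l,
    rhohat phi FX FY s k l ^+ 2 <= c * Tstat phi FX FY s.
Proof.
have [c c0 sandwich] := entry_le_frobenius_sandwich (invsqrtmx_unit (Sigma phi)).
exists (c ^+ 2) => [|FX FY n s k l]; first exact: exprn_gt0.
rewrite -[leLHS]real_normK ?num_real// /Tstat -exprMn lerXn2r ?nnegrE//.
by rewrite mulr_ge0 ?(ltW c0)//; exact: sqrtr_ge0.
Qed.

Lemma outer_measure_setC_prob1 dd (T : measurableType dd) (R : realType)
    (Q : probability T R) (A : set T) :
  measurable A -> Q A = 1%E -> ((Q^* (~` A))%mu <= 0)%E.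
Proof.
move=> mA QA; have QC : Q (~` A) = 0%E by rewrite probability_setC// QA subee.
by rewrite (etrans (measurable_mu_extE Q (measurableC mA)) QC).
Qed.

(** The exceptional event of a supremum over z need not be measurable, hence the
outer measure for the cover B. *)
Lemma probability_ge_cover dd (T : measurableType dd) (R : realType)
    (Q : probability T R) (E B : set T) (e : R) :
  measurable E -> ~` E `<=` B -> ((Q^* B)%mu <= e%:E)%E -> ((1 - e)%:E <= Q E)%E.
Proof.
move=> mE EB Be.
have QC : (Q (~` E) <= e%:E)%E.
  rewrite -(@measurable_mu_extE _ _ _ Q _ (measurableC mE)).
  by apply: le_trans Be; exact: le_mu_ext.
rewrite -[E]setCK probability_setC; last exact: measurableC.
by rewrite EFinB leeB.
Qed.

Lemma limn_einf_to1 (R : realType) (u : nat -> \bar R) :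
  (forall n, u n <= 1)%E ->
  (forall eps : R, 0 < eps -> \forall n \near \oo, ((1 - eps)%:E <= u n)%E) ->
  limn_einf u = 1%E.
Proof.
move=> u1 ueps; apply: (cvg_limn_einf_sup _).1.
have near_fin : \forall n \near \oo, u n \is a fin_num.
  apply: filterS (ueps 1 ltr01) => n; rewrite subrr => un.
  by rewrite ge0_fin_numE// (le_lt_trans (u1 n))// ltry.
apply/fine_cvgP; split => //; apply/cvgrPdist_le => e e0.
near=> n; have fin : u n \is a fin_num by near: n.
have := u1 n; have : ((1 - e)%:E <= u n)%E by near: n; exact: ueps.
by rewrite -(fineK fin) !lee_fin /= ler_norml; lra.
Unshelve. all: by end_near. Qed.

Lemma near_inv_lt (R : realType) (c theta : R) : 0 < theta ->
  \forall n \near \oo, (n%:R : R)^-1 * c < theta.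
Proof.
move=> t0; near=> n; have n0 : 0 < n%:R :> R by near: n; exact: nbhs_infty_gtr.
rewrite ltr_pdivrMl// -ltr_pdivrMr//; near: n; exact: nbhs_infty_gtr.
Unshelve. all: by end_near. Qed.

Lemma near_scaled_le (R : realType) (a : nat -> R) (K delta : R) :
  a n @[n --> \oo] --> (0 : R) -> 0 < K -> 0 < delta ->
  \forall n \near \oo, K * `|a n| <= delta.
Proof.
move=> a0 K0 d0; have dK : 0 < K^-1 * delta by rewrite mulr_gt0// invr_gt0.
have /cvgr0Pnorm_le/(_ _ dK) := a0.
by apply: filterS => n; rewrite ler_pdivlMl.
Unshelve. all: by end_near. Qed.

Lemma mean_close (R : realType) n (a b : 'I_n -> R) (e : R) :
  (0 < n)%N -> (forall i, `|a i - b i| <= e) ->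
  `|n%:R^-1 * \sum_(i < n) a i - n%:R^-1 * \sum_(i < n) b i| <= e.
Proof.
move=> n0 ab; have nR : 0 < n%:R :> R by rewrite ltr0n.
rewrite -mulrBr -sumrB normrM ger0_norm ?invr_ge0//.
rewrite ler_pdivrMl// (le_trans (ler_norm_sum _ _ _))//.
apply: (@le_trans _ _ (\sum_(i < n) e)); first exact: ler_sum.
by rewrite sumr_const card_ord mulr_natl.
Qed.

Unset Implicit Arguments.
Theorem corollary23 (R : realType) (d q : nat) (q_gt0 : (0 < q)%N)
  (phi : R -> 'cV[R]_q) (phi_score : is_score phi)
  (FhatX FhatY : estimator R d)
  (FhatX_est : is_estimator FhatX) (FhatY_est : is_estimator FhatY)
  (P0 : set (probability (Obs R d) R)) (P0_sub : P0 `<=` @calP R d)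
  (kX kY : probability (Obs R d) R -> R.-pker (Zvec R d) ~> measurableTypeR R)
  (kX_cond : forall P, P0 P -> cont_cond_dist P (@obsX R d) (kX P))
  (kY_cond : forall P, P0 P -> cont_cond_dist P (@obsY R d) (kY P))
  (g h : nat -> R)
  (g_neq0 : forall n, (0 < n)%N -> g n != 0)
  (h_neq0 : forall n, (0 < n)%N -> h n != 0)
  (g_cvg0 : g n @[n --> \oo] --> (0 : R))
  (h_cvg0 : h n @[n --> \oo] --> (0 : R))
  (xi xi' : R -> Zvec R d -> R)
  (X_inner : stochO P0 (fun n P s =>
     normT (kX P) (tau_min phi) (tau_max phi)
       (fun t z => cond_cdf (kX P) t z - FhatX n (sampleXZ s) t z)) g)
  (Y_inner : stochO P0 (fun n P s =>
     normT (kY P) (tau_min phi) (tau_max phi)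
       (fun t z => cond_cdf (kY P) t z - FhatY n (sampleYZ s) t z)) h)
  (X_outer : stochO P0 (fun n P s =>
     normTc (kX P) (tau_min phi) (tau_max phi)
       (fun t z => xi t z - FhatX n (sampleXZ s) t z)) g)
  (Y_outer : stochO P0 (fun n P s =>
     normTc (kY P) (tau_min phi) (tau_max phi)
       (fun t z => xi' t z - FhatY n (sampleYZ s) t z)) h) :
  forall alpha : R, 0 < alpha < 1 ->
  forall lambda : R, 0 < lambda ->
  calA phi P0 kX kY lambda !=set0 ->
  limn_einf (fun n =>
    ereal_inf [set ('E_(iid P n)[@Psihat R d q phi FhatX FhatY alpha n])%E
              | P in calA phi P0 kX kY lambda]) = 1%E.
Proof.
move=> alpha _ lambda lambda0 [P1 P1A].
pose c := @chi2_quantile R (q ^ 2)%N (1 - alpha).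
have [L L0 lip] := score_lipschitz phi_score.
have [c0 c00 rho_T] := le_sqr_rhohat_Tstat d phi.
pose reject n := [set s : n.-tuple (Obs R d) | n%:R^-1 * c < Tstat phi FhatX FhatY s].
have mreject n : measurable (reject n).
  have := @measurable_Tstat R q d phi phi_score FhatX FhatY FhatX_est FhatY_est n.
  move=> /(_ measurableT _ (measurable_itv `]n%:R^-1 * c, +oo[)).
  by rewrite setTI preimage_itvoy.
have EPsi n (P : probability (Obs R d) R) :
    ('E_(iid P n)[@Psihat R d q phi FhatX FhatY alpha n] = iid P n (reject n))%E.
  rewrite -(expectation_indic (iid P n) (mreject n)); congr expectation.
  apply/funext => s; rewrite /Psihat indicE.
  by case: ifPn => h'; [rewrite mem_set|rewrite memNset//; exact/negP].
(* The infimum runs over a nonempty set, so it is at most 1. *)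
apply: limn_einf_to1 => [n|eps eps0].
  apply: (@le_trans _ _ ('E_(iid P1 n)[Psihat phi FhatX FhatY alpha (n:=n)])%E).
    by apply: ereal_inf_lbound; exists P1.
  by rewrite EPsi; apply: (@probability_le1 _ _ _ (iid P1 n)); exact: mreject.
suff power : \forall n \near \oo, forall P,
    calA phi P0 kX kY lambda P -> ((1 - eps)%:E <= iid P n (reject n))%E.
  by apply: filterS power => n Pn; apply: le_ereal_inf_tmp => _ [P PA <-]; rewrite EPsi; exact: Pn.
(* One share of eps for each estimator and one for the deviation of the mean. *)
pose e := eps / 3; have e0 : 0 < e by rewrite divr_gt0.
(* This delta makes the error L ^ 2 (delta + delta) of replacing fitted values by
   true ranks equal to lambda / 4. *)
pose delta := lambda / (8 * L ^+ 2).
have delta0 : 0 < delta by rewrite divr_gt0// mulr_gt0// exprn_gt0.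
have [KX KX0 HX] := X_inner e e0.
have [KY KY0 HY] := Y_inner e e0.
near=> n => P PA.
have n0 : (0 < n)%N by near: n; exact: nbhs_infty_gt.
have gn : KX * `|g n| <= delta by near: n; exact: near_scaled_le.
have hn : KY * `|h n| <= delta by near: n; exact: near_scaled_le.
(* The threshold c / n tends to zero whatever the value of the quantile c. *)
have cn : n%:R^-1 * c < (lambda / 2) ^+ 2 / c0.
  by near: n; apply: near_inv_lt; rewrite divr_gt0// exprn_gt0// divr_gt0.
have vn : n%:R^-1 * ((2 * L ^+ 2) ^+ 2 / (lambda / 4) ^+ 2) < e.
  by near: n; exact: near_inv_lt.
case: PA => [[P0P _] [k [l rho_kl]]].
have [Pcube _] := P0_sub P P0P.
pose f w := phi (cond_cdf (kX P) (obsX w) (obsZ w)) k 0 *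
            phi (cond_cdf (kY P) (obsY w) (obsZ w)) l 0.
have mf : measurable_fun setT f.
  apply: measurable_funM.
    apply: (measurableT_comp (measurable_score phi_score k)).
    exact: (measurable_true_rank (@measurable_obsX R d)).
  apply: (measurableT_comp (measurable_score phi_score l)).
  exact: (measurable_true_rank (@measurable_obsY R d)).
have fL w : `|f w| <= L ^+ 2.
  by rewrite normrM expr2 ler_pM// score_bounded.
have rhoE : rho phi P (kX P) (kY P) k l = fine 'E_P[f].
  rewrite mxE; congr (fine (expectation _ _)); apply/funext => w.
  by rewrite mxE big_ord1 mxE.
have lam4 : 0 < lambda / 4 by rewrite divr_gt0.
pose D := [set s : n.-tuple (Obs R d) |
   lambda / 4 <= `|n%:R^-1 * \sum_(i < n) f (tnth s i) - fine 'E_P[f]|].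
have PD : (iid P n D <= e%:E)%E.
  apply: le_trans (weak_law P n0 lam4 mf fL) _; rewrite lee_fin.
  by rewrite invfM mulrCA ltW.
have mD : measurable D by exact: measurable_mean_deviation.
pose C := [set s : n.-tuple (Obs R d) | forall i, obs_cube (tnth s i)].
have mC : measurable C by apply: measurable_all_tnth; exact: measurable_obs_cube.
have PC : iid P n C = 1%E by apply: iid_all => //; exact: measurable_obs_cube.
pose BX := [set s : n.-tuple (Obs R d) | (KX%:E < `|normT (kX P) (tau_min phi) (tau_max phi)
       (fun t z => cond_cdf (kX P) t z - FhatX n (sampleXZ s) t z)%R * (g n)^-1%:E|)%E].
pose BY := [set s : n.-tuple (Obs R d) | (KY%:E < `|normT (kY P) (tau_min phi) (tau_max phi)
       (fun t z => cond_cdf (kY P) t z - FhatY n (sampleYZ s) t z)%R * (h n)^-1%:E|)%E].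
have PBX : (((iid P n)^* BX)%mu <= e%:E)%E.
  apply/ltW/(le_lt_trans _ HX)/ereal_sup_ubound; by exists n, P.
have PBY : (((iid P n)^* BY)%mu <= e%:E)%E.
  apply/ltW/(le_lt_trans _ HY)/ereal_sup_ubound; by exists n, P.
have cubeX w : @obs_cube R d w -> 0 <= obsX w <= 1 by case; rewrite in_itv.
have cubeY w : @obs_cube R d w -> 0 <= obsY w <= 1 by case=> _; rewrite in_itv.
(* Acceptance forces a sample point off the cube, a large deviation of the mean,
   or a failure of one of the two estimators. *)
have accept_sub : ~` reject n `<=` (~` C `|` D) `|` (BX `|` BY).
  move=> s accept; apply: contrapT => good.
  have Cs : C s by apply: contrapT => ?; apply: good; left; left.
  have Ds : ~ D s by move=> ?; apply: good; left; right.
  have BXs : ~ BX s by move=> ?; apply: good; right; left.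
  have BYs : ~ BY s by move=> ?; apply: good; right; right.
  apply: accept; rewrite /reject /=.
  have closeX := fitted_score_close q_gt0 phi_score L0 lip FhatX_est (kX_cond P P0P)
    (g_neq0 n n0) Cs cubeX BXs.
  have closeY := fitted_score_close q_gt0 phi_score L0 lip FhatY_est (kY_cond P P0P)
    (h_neq0 n n0) Cs cubeY BYs.
  have rho_close : `|rhohat phi FhatX FhatY s k l -
      n%:R^-1 * \sum_(i < n) f (tnth s i)| <= lambda / 4.
    rewrite rhohatE; apply: mean_close => // i.
    apply: (le_trans (score_product_close phi_score L0 lip (closeX i k) (closeY i l))).
    have -> : lambda / 4 = L ^+ 2 * (delta + delta).
      by rewrite /delta; field; rewrite gt_eqF.
    by rewrite ler_pM2l ?exprn_gt0// lerD.
  move: Ds rho_kl; rewrite /D /= rhoE => /negP; rewrite -ltNge => Ds rho_kl.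
  have rho_big : (lambda / 2) ^+ 2 < rhohat phi FhatX FhatY s k l ^+ 2.
    rewrite -[ltRHS]real_normK ?num_real// ltrXn2r ?nnegrE ?divr_ge0 ?(ltW lambda0)//.
    move: rho_close Ds rho_kl; move: (rhohat _ _ _ _ _ _) => r1.
    move: (_^-1 * _) (fine _) => r2 r3.
    rewrite ler_distl ltr_norml => /andP[u1 u2] /andP[u3 u4].
    have := ler_norm r1; have := ler_norm (- r1); rewrite normrN => v1 v2.
    have [r30|r30] := leP 0 r3.
      by rewrite (ger0_norm r30); lra.
    by rewrite (ltr0_norm r30); lra.
  apply: (lt_trans cn); rewrite ltr_pdivrMr// [ltRHS]mulrC.
  exact: lt_le_trans rho_big (rho_T _ _ _ _ _ _).
apply: (probability_ge_cover (mreject n) accept_sub).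
have PCc : (((iid P n)^* (~` C))%mu <= 0)%E.
  exact: outer_measure_setC_prob1.
have PD_ext : (((iid P n)^* D)%mu <= e%:E)%E by rewrite measurable_mu_extE.
have -> : eps%:E = (0 + e%:E + (e%:E + e%:E))%E.
  by rewrite add0e -!EFinD /e; congr EFin; field.
apply: (le_trans (outer_measureU2 _ _ _)); apply: leeD.
  apply: (le_trans (outer_measureU2 _ _ _)); apply: leeD; first exact: PCc.
  exact: PD_ext.
by apply: (le_trans (outer_measureU2 _ _ _)); apply: leeD.
Unshelve. all: by end_near. Qed.
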